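(* Let $m\ge2$, $h_1,\dots,h_m\in\{x_1,\dots,x_n\}$, and assume $p_{h_1,h_1}\neq1$ in case $\mu(h_1\cdots h_m)=\{h_1\}$. Then: (a) If either ($h_1\cdots h_{m-1}\in\mathfrak{L}(V)$ and $h_1\cdots h_{m-1}\diamond h_m$) or ($h_2\cdots h_m\in\mathfrak{L}(V)$ and $h_2\cdots h_m\diamond h_1$), then $h_1h_2\cdots h_m\in\mathfrak{L}(V)$. (b) If $0\neq h_1\cdots h_m\in\mathfrak{L}(V)$, then there is $\tau\in\mathbb{S}_m$ with $h_1\cdots h_m\sim h_{\tau(1)}\cdots h_{\tau(m)}$ such that either $0\neq h_{\tau(1)}\cdots h_{\tau(m-1)}\in\mathfrak{L}(V)$ and $h_{\tau(1)}\cdots h_{\tau(m-1)}\diamond h_{\tau(m)}$, or $0\neq h_{\tau(2)}\cdots h_{\tau(m)}\in\mathfrak{L}(V)$ and $h_{\tau(2)}\cdots h_{\tau(m)}\diamond h_{\tau(1)}$. (c) If the monomial $h_1\cdots h_m$ is connected, then $h_1\cdots h_m\in\mathfrak{L}(V)$.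
   Context: $V$ is a braided vector space of diagonal type over an algebraically closed field $F$ of characteristic $0$, with basis $x_1,\dots,x_n$, braiding $C(x_i\otimes x_j)=q_{ij}x_j\otimes x_i$, Nichols algebra $\mathfrak{B}(V)$ ($\mathbb{Z}^n$-graded, $\deg x_i=e_i$). $\chi$ is the bicharacter with $\chi(e_i,e_j)=q_{ij}$, $p_{ij}:=q_{ij}$, $p_{uv}:=\chi(\deg u,\deg v)$ for homogeneous $u,v$, $\tilde p_{x_i,x_j}:=p_{ij}p_{ji}$. For homogeneous $x,y$, $[x,y]:=yx-p_{yx}xy$, and $\mathfrak{L}(V)$ is the linear span in $\mathfrak{B}(V)$ of all iterated brackets (any bracketing) of $x_1,\dots,x_n$. A monomial is a word $h_1\cdots h_m$ in the letters $x_1,\dots,x_n$, also regarded as an element of $\mathfrak{B}(V)$; $\mu(\cdot)$ is its set of letters. $\Gamma(V)$ has vertices $1,\dots,n$ and edge $\{i,j\}$ ($i\ne j$) iff $p_{ij}p_{ji}\ne1$; a monomial is connected iff the subgraph of $\Gamma(V)$ induced on its letters is connected (a single vertex is connected). For monomials $v,w$, $v\diamond w$ means there exist $x_i\in\mu(v),x_j\in\mu(w)$ with $\tilde p_{x_i,x_j}\ne1$. $u\sim v$ means $u=av$ for some $a\in F^*$. *)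

(* Defs.v *)
From HB Require Import structures.
From mathcomp Require Import all_boot all_order all_algebra all_fingroup.
Set Implicit Arguments. Unset Strict Implicit. Unset Printing Implicit Defensive.
Import GRing.Theory.
Local Open Scope ring_scope.

(* Braided vector space of diagonal type with braiding matrix q (q i j = q_ij),
   basis x_0 .. x_{n-1} indexed by 'I_n.  Elements of the tensor algebra T(V)
   are represented as formal finite sums  sum c * (word), i.e. seq (F * word);
   a word [:: a1; ..; ak] stands for x_a1 ... x_ak.  Elements of B(V) are
   represented by representatives in T(V); B(V) = T(V)/I(V) with I(V) the
   Nichols ideal, characterised through skew derivations. *)

Section Nichols.
Variables (F : fieldType) (n : nat) (q : 'I_n -> 'I_n -> F).

Definition word := seq 'I_n.
Definition tv := seq (F * word).

Definition mono (w : word) : tv := [:: (1, w)].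
Definition addT (u v : tv) : tv := u ++ v.
Definition scaleT (c : F) (u : tv) : tv := [seq (c * p.1, p.2) | p <- u].
Definition mulT (u v : tv) : tv :=
  [seq (p.1 * p'.1, p.2 ++ p'.2) | p <- u, p' <- v].

Definition chiw (u v : word) : F := \prod_(a <- u) \prod_(b <- v) q a b.

(* right skew derivation d_i on T(V), determined by
   Delta(u) in u(x)1 + sum_i d_i(u) (x) x_i + ...,  i.e.
   d_i(x_j) = delta_ij,  d_i(uv) = u d_i(v) + chi(e_i, deg v) d_i(u) v. *)
Fixpoint dw (i : 'I_n) (w : word) : tv :=
  match w with
  | [::] => [::]
  | a :: w' => [seq (p.1, a :: p.2) | p <- dw i w'] ++
               (if a == i then [:: (\prod_(l <- w') q i l, w')] else [::])
  end.

Definition dT (i : 'I_n) (u : tv) : tv :=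
  flatten [seq scaleT p.1 (dw i p.2) | p <- u].

Definition constT (u : tv) : F := \sum_(p <- u | p.2 == [::]) p.1.

Definition evalD (s : word) (u : tv) : F := constT (foldr dT u s).

Definition zeroB (u : tv) : Prop := forall s : word, evalD s u = 0.
Definition eqB (u v : tv) : Prop := zeroB (addT u (scaleT (-1) v)).

Inductive btree := BLeaf of 'I_n | BNode of btree & btree.

Fixpoint leaves (t : btree) : word :=
  match t with BLeaf i => [:: i] | BNode t1 t2 => leaves t1 ++ leaves t2 end.

(* [x, y] := y x - p_{y x} x y *)
Fixpoint evB (t : btree) : tv :=
  match t with
  | BLeaf i => mono [:: i]
  | BNode x y => addT (mulT (evB y) (evB x))
                      (scaleT (- chiw (leaves y) (leaves x)) (mulT (evB x) (evB y)))
  end.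

Definition lincomb (l : seq (F * btree)) : tv :=
  flatten [seq scaleT p.1 (evB p.2) | p <- l].

Definition inL (u : tv) : Prop := exists l : seq (F * btree), eqB u (lincomb l).

Definition simB (u v : tv) : Prop := exists a : F, a != 0 /\ eqB u (scaleT a v).

Definition diamond (v w : word) : bool :=
  has (fun a => has (fun b => q a b * q b a != 1) w) v.

Definition gamma_on (w : word) : rel 'I_n :=
  fun x y => [&& x \in w, y \in w, x != y & q x y * q y x != 1].
Definition connected_word (w : word) : bool :=
  [forall a, forall b, (a \in w) ==> (b \in w) ==> connect (gamma_on w) a b].

End Nichols.

Definition permw (T : Type) (h : seq T) (tau : 'S_(size h)) : seq T :=
  [seq tnth (in_tuple h) (tau i) | i <- enum 'I_(size h)].

Arguments mono {F n} w.

(* Main.v *)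
Require Import Defs.
From HB Require Import structures.
From mathcomp Require Import all_boot all_order all_algebra all_fingroup.
From mathcomp Require Import ring zify.
Set Implicit Arguments. Unset Strict Implicit. Unset Printing Implicit Defensive.
Import GRing.Theory.
Local Open Scope ring_scope.

(* If the words [w] and [x] lie in L(V), then so does [x w - chi(x, w) w x], so modulo L(V)
   factors of a word that lie in L(V) can be cyclically rotated up to a scalar, and a word
   lies in L(V) as soon as two ways of rotating it produce different scalars. Part (c) is
   proved by induction on the length. From a connected word one repeatedly removes a letter
   which can be commuted to one end and whose removal leaves a connected word; the removed
   letters are collected in a word [u]. Either the scalars differ at some stage, or every new
   letter commutes up to a scalar with those in [u]; at the latest when all letters have been
   removed the scalars differ, because the word is connected. A monomial of L(V) which is not
   connected vanishes, since letters in different components commute up to the scalar that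
   occurs in the bracket. This reduces (a) to (c), and (b) to the combinatorics of removing a
   letter. *)

(** * The Nichols ideal *)

Section NicholsIdeal.
Variables (F : fieldType) (n : nat) (q : 'I_n -> 'I_n -> F).
Implicit Types (s w x y : word n) (u v : tv F n) (i a b : 'I_n).

Definition lext u (g : word n -> F) : F := \sum_(p <- u) p.1 * g p.2.

(** Gram matrix of the form on T(V) whose radical is the Nichols ideal; the last letter of [s] is
    the derivation applied first. *)
Definition pairing s w : F := evalD q s (mono w).

Lemma dT_cat i u v : dT q i (u ++ v) = dT q i u ++ dT q i v.
Proof. by rewrite /dT map_cat flatten_cat. Qed.

Lemma dT_scale i c u : dT q i (scaleT c u) = scaleT c (dT q i u).
Proof.
rewrite /dT /scaleT map_flatten -!map_comp; congr flatten.
apply: eq_map => p /=; rewrite -map_comp; apply: eq_map => r /=.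
by rewrite mulrA.
Qed.

Lemma evalD_cat s u v : evalD q s (u ++ v) = evalD q s u + evalD q s v.
Proof.
elim/last_ind: s u v => [|s i IHs] u v; first by rewrite /evalD /constT big_cat.
by rewrite /evalD !foldr_rcons dT_cat; exact: IHs.
Qed.

Lemma evalD_scale s c u : evalD q s (scaleT c u) = c * evalD q s u.
Proof.
elim/last_ind: s u => [|s i IHs] u.
  by rewrite /evalD /constT /scaleT /= big_map /= mulr_sumr.
by rewrite /evalD !foldr_rcons dT_scale; exact: IHs.
Qed.

Lemma evalD_rcons s i u : evalD q (rcons s i) u = evalD q s (dT q i u).
Proof. by rewrite /evalD foldr_rcons. Qed.

Lemma evalD_nil s : evalD q s [::] = 0.
Proof.
by elim/last_ind: s => [|s i IHs]; rewrite ?evalD_rcons // /evalD /constT big_nil.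
Qed.

Lemma evalDE s u : evalD q s u = lext u (pairing s).
Proof.
elim: u => [|[c w] u IHu]; first by rewrite evalD_nil /lext big_nil.
rewrite /lext big_cons -/(lext _ _) -IHu -evalD_scale -evalD_cat.
by rewrite /scaleT /= mulr1.
Qed.

Lemma eqBP u v : eqB q u v <-> forall s, evalD q s u = evalD q s v.
Proof.
split=> H s; have := H s; rewrite evalD_cat evalD_scale mulN1r.
  by move/subr0_eq.
by move=> ->; rewrite subrr.
Qed.

Lemma lext_cat u v g : lext (u ++ v) g = lext u g + lext v g.
Proof. by rewrite /lext big_cat. Qed.

Lemma lext_scale c u g : lext (scaleT c u) g = c * lext u g.
Proof. by rewrite /lext big_map mulr_sumr; apply: eq_bigr => p _; rewrite mulrA. Qed.

Lemma lext_mono w g : lext (mono w) g = g w.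
Proof. by rewrite /lext big_seq1 mul1r. Qed.

Lemma lext_map (f : word n -> word n) u g :
  lext [seq (p.1, f p.2) | p <- u] g = lext u (g \o f).
Proof. by rewrite /lext big_map. Qed.

Lemma lext_lin u c d g g' :
  lext u (fun w => c * g w + d * g' w) = c * lext u g + d * lext u g'.
Proof.
by rewrite /lext !mulr_sumr -big_split /=; apply: eq_bigr => p _; ring.
Qed.

Lemma eq_lext u g g' : g =1 g' -> lext u g = lext u g'.
Proof. by move=> E; apply: eq_bigr => p _; rewrite E. Qed.

Lemma lext_dT i u g : lext (dT q i u) g = lext u (fun w => lext (dw q i w) g).
Proof.
elim: u => [|[c w] u IHu]; first by rewrite /lext /= !big_nil.
rewrite -cat1s dT_cat !lext_cat IHu; congr (_ + _).
by rewrite /dT /= lext_scale /lext big_nil big_seq1 addr0.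
Qed.

Lemma pairing_nil w : pairing [::] w = (w == [::])%:R.
Proof. by rewrite /pairing /evalD /constT /= big_mkcond big_seq1 /=; case: eqP. Qed.

Lemma pairing_rcons s i w : pairing (rcons s i) w = lext (dw q i w) (pairing s).
Proof. by rewrite /pairing evalD_rcons evalDE lext_dT lext_mono. Qed.

Lemma lext_dw_cons i a w g :
  lext (dw q i (a :: w)) g
  = lext (dw q i w) (fun t => g (a :: t)) + (a == i)%:R * ((\prod_(l <- w) q i l) * g w).
Proof.
rewrite /= lext_cat lext_map; congr (_ + _).
by case: eqP => _; rewrite /lext ?big_seq1 ?big_nil ?mul1r ?mul0r.
Qed.

(** [dw] recurses on the first letter; this is the twisted Leibniz rule at the other end of the
    word. *)
Lemma lext_dw_rcons i a w g :
  lext (dw q i (rcons w a)) g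
  = q i a * lext (dw q i w) (fun t => g (rcons t a)) + (a == i)%:R * g w.
Proof.
elim: w g => [|b w IHw] g.
  by rewrite lext_dw_cons /lext /= !big_nil !(mulr0, add0r) mul1r.
rewrite rcons_cons !lext_dw_cons IHw -cats1 big_cat big_seq1 /= cats1; ring.
Qed.

Lemma dw_perm i w p : p \in dw q i w -> perm_eq (i :: p.2) w.
Proof.
elim: w p => [|a w IHw] //= p; rewrite mem_cat => /orP[/mapP[r rw ->]|] /=.
  have := IHw _ rw; rewrite -(perm_cons a); apply: perm_trans.
  by rewrite (perm_catCA [:: i] [:: a] r.2).
by case: eqP => [->|_] //=; rewrite inE => /eqP->.
Qed.

(** Each derivation d_i strips off one letter i, so a nonzero constant is left only if [s] uses up
    exactly the letters of [w]. *)
Lemma pairing_perm s w : pairing s w != 0 -> perm_eq s w.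
Proof.
elim/last_ind: s w => [|s i IHs] w; first by rewrite pairing_nil; case: w; rewrite //= eqxx.
rewrite pairing_rcons; apply: contraR => nsw; apply/eqP.
rewrite /lext big_seq big1 // => p pw; case: (eqVneq (pairing s p.2) 0) => [->|].
  by rewrite mulr0.
move=> /IHs sp; case/negP: nsw; rewrite perm_rcons.
by rewrite (perm_trans _ (dw_perm pw)) // perm_cons.
Qed.

Lemma zeroBE u : zeroB q u <-> forall s, lext u (pairing s) = 0.
Proof. by split=> H s; have := H s; rewrite evalDE. Qed.

Lemma zeroB_dT i u : zeroB q u -> zeroB q (dT q i u).
Proof. by move=> Zu s; rewrite -evalD_rcons. Qed.

(** Induction on the number of derivations, by d_i(u x_a) = q_ia d_i(u) x_a + delta_ia u, where
    d_i(u) vanishes in B(V) along with u. *)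
Lemma zeroB_rcons a u : zeroB q u -> zeroB q [seq (p.1, rcons p.2 a) | p <- u].
Proof.
move=> Zu; apply/zeroBE => s; elim/last_ind: s u Zu => [|s i IHs] u Zu.
  by rewrite (lext_map (rcons^~ a)) /lext big1 // => -[c [|b w]] _; rewrite /= pairing_nil mulr0.
rewrite (lext_map (rcons^~ a)).
under eq_lext => w do rewrite /= pairing_rcons lext_dw_rcons.
rewrite lext_lin; have /zeroBE-> := Zu.
rewrite -(@lext_dT i u (fun t => pairing s (rcons t a))).
by have := IHs _ (zeroB_dT i Zu); rewrite (lext_map (rcons^~ a)) => ->; rewrite !mulr0 addr0.
Qed.

Lemma zeroB_cons a u : zeroB q u -> zeroB q [seq (p.1, a :: p.2) | p <- u].
Proof.
move=> Zu; apply/zeroBE => s; elim/last_ind: s u Zu => [|s i IHs] u Zu.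
  by rewrite (lext_map (cons a)) /lext big1 // => p _; rewrite /= pairing_nil mulr0.
rewrite (lext_map (cons a)).
(* In d_i(x_a w) the factor chi(e_i, deg w) depends on [w], but only rearrangements of [s] pair with
   [s], so it can be computed from [s] and taken out of the sum. *)
have E w : pairing (rcons s i) (a :: w) = 1 * lext (dw q i w) (fun t => pairing s (a :: t))
    + ((a == i)%:R * \prod_(l <- s) q i l) * pairing s w.
  rewrite pairing_rcons lext_dw_cons mul1r -mulrA; congr (_ + _ * _).
  case: (eqVneq (pairing s w) 0) => [->|/pairing_perm sw]; first by rewrite !mulr0.
  by rewrite (perm_big _ sw).
under eq_lext => w do rewrite /= E.
rewrite lext_lin; have /zeroBE-> := Zu.
rewrite -(@lext_dT i u (fun t => pairing s (a :: t))).
by have := IHs _ (zeroB_dT i Zu); rewrite (lext_map (cons a)) => ->; rewrite !mulr0 addr0.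
Qed.

Lemma zeroB_ctx x y u :
  zeroB q u -> forall s, lext u (fun w => pairing s (x ++ w ++ y)) = 0.
Proof.
move=> Zu; suff: zeroB q [seq (p.1, x ++ p.2 ++ y) | p <- u].
  by move=> /zeroBE H s; have := H s; rewrite (lext_map (fun w => x ++ w ++ y)).
have: zeroB q [seq (p.1, p.2 ++ y) | p <- u].
  elim/last_ind: y => [|y a IHy].
    by apply/zeroBE => s; rewrite (lext_map (fun w => w ++ [::])); under eq_lext => w do rewrite /= cats0; exact: (zeroBE u).1.
  have := zeroB_rcons a IHy; congr zeroB; rewrite -map_comp; apply: eq_map => p /=.
  by rewrite rcons_cat.
elim: x => [|a x IHx] // /IHx Zx; have := zeroB_cons a Zx.
by congr zeroB; rewrite -map_comp.
Qed.

Lemma evalD_mulT s u v :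
  evalD q s (mulT u v) = lext u (fun w => lext v (fun w' => pairing s (w ++ w'))).
Proof.
rewrite evalDE /lext /mulT big_allpairs_dep; apply: eq_bigr => p _.
by rewrite mulr_sumr; apply: eq_bigr => r _; rewrite mulrA.
Qed.

Lemma exchange_lext u v (g : word n -> word n -> F) :
  lext u (fun w => lext v (g w)) = lext v (fun w' => lext u (g^~ w')).
Proof.
rewrite /lext; under eq_bigr do rewrite mulr_sumr.
rewrite exchange_big; apply: eq_bigr => p _; rewrite mulr_sumr.
by apply: eq_bigr => r _; rewrite mulrCA.
Qed.

Lemma lext_eqB x y u u' : eqB q u u' -> forall s,
  lext u (fun w => pairing s (x ++ w ++ y)) = lext u' (fun w => pairing s (x ++ w ++ y)).
Proof.
move=> E s; have := zeroB_ctx x y E s; rewrite lext_cat lext_scale mulN1r.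
by move/subr0_eq.
Qed.

Lemma mulT_eqB u u' v v' :
  eqB q u u' -> eqB q v v' -> eqB q (mulT u v) (mulT u' v').
Proof.
move=> Eu Ev; apply/eqBP => s; rewrite !evalD_mulT.
transitivity (lext u (fun w => lext v' (fun w' => pairing s (w ++ w')))).
  apply: eq_lext => w; have := lext_eqB w [::] Ev s.
  by under eq_lext do rewrite cats0; under [RHS]eq_lext do rewrite cats0.
by rewrite !(exchange_lext _ v'); apply: eq_lext => w; have := lext_eqB [::] w Eu s.
Qed.

Lemma zeroB_mono_ctx x y w : zeroB q (mono w) -> zeroB q (mono (x ++ w ++ y)).
Proof. by move=> /(zeroB_ctx x y) Z s; have := Z s; rewrite lext_mono. Qed.

(** For distinct letters: no edge in Gamma(V). For a = b: q_aa is 1 or -1. *)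
Definition qtriv a b := q a b * q b a == 1.

Lemma qtriv_sym a b : qtriv a b = qtriv b a.
Proof. by rewrite /qtriv mulrC. Qed.

(** When q_ab q_ba = 1, every skew derivation kills x_b x_a - q_ba x_a x_b, also if a = b. *)
Lemma pairing_swap x y a b s : qtriv a b ->
  pairing s (x ++ b :: a :: y) = q b a * pairing s (x ++ a :: b :: y).
Proof.
move=> /eqP tab; suff Z: zeroB q [:: (1, [:: b; a]); (- q b a, [:: a; b])].
  have := zeroB_ctx x y Z s; rewrite /lext big_cons big_seq1 /= mul1r mulNr.
  by move/subr0_eq.
move=> {}s; rewrite evalDE /lext big_cons big_seq1 /=.
case/lastP: s => [|s i]; first by rewrite !pairing_nil !mulr0 addr0.
rewrite !pairing_rcons !lext_dw_cons /lext /= !big_nil !big_seq1.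
case: (eqVneq a i) => [ai|_]; case: (eqVneq b i) => [bi|_]; rewrite ?ai ?bi ?mulr1n ?mulr0n; try by ring.
- by rewrite ai bi in tab; ring: tab.
- rewrite ai in tab; ring: tab.
Qed.
End NicholsIdeal.

(** * Brackets of monomials *)

Section BraidedLie.
Variables (F : fieldType) (n : nat) (q : 'I_n -> 'I_n -> F).
Hypothesis q_neq0 : forall i j, q i j != 0.
Implicit Types (s w x y : word n) (u v : tv F n) (a b c : 'I_n) (t : btree n).

Lemma chiw_cons a w x : chiw q (a :: w) x = chiw q [:: a] x * chiw q w x.
Proof. by rewrite /chiw big_cons big_seq1. Qed.

Lemma chiw_catr w x y : chiw q w (x ++ y) = chiw q w x * chiw q w y.
Proof. by rewrite /chiw -big_split; apply: eq_bigr => a _; rewrite big_cat. Qed.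

Lemma chiw11 a b : chiw q [:: a] [:: b] = q a b.
Proof. by rewrite /chiw !big_seq1. Qed.

Lemma chiw_perm w w' x x' : perm_eq w w' -> perm_eq x x' -> chiw q w x = chiw q w' x'.
Proof.
move=> pw px; rewrite /chiw (perm_big _ pw); apply: eq_bigr => a _.
exact: perm_big.
Qed.

Lemma chiw_neq0 w x : chiw q w x != 0.
Proof. by do 2 (rewrite prodf_seq_neq0; apply/allP => ? _ /=); apply: q_neq0. Qed.

Lemma pairing_move x y w a s : all (qtriv q a) w ->
  pairing q s (x ++ w ++ a :: y) = chiw q w [:: a] * pairing q s (x ++ a :: w ++ y).
Proof.
elim: w x => [|b w IHw] x /=; first by rewrite /chiw big_nil mul1r.
case/andP=> tab taw; have := IHw (rcons x b) taw; rewrite !cat_rcons => ->.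
rewrite chiw_cons chiw11 pairing_swap //; ring.
Qed.

(** Swapping the two equal letters multiplies the value by q_aa, which is not 1. *)
Lemma pairing_sq x y a s : qtriv q a a -> q a a != 1 -> pairing q s (x ++ a :: a :: y) = 0.
Proof.
move=> taa qa; apply/eqP; have := pairing_swap x y s taa.
move/eqP; rewrite -subr_eq0 -{1}[pairing _ _ _]mul1r -mulrBl mulf_eq0 => /orP[|//].
by rewrite subr_eq0 eq_sym (negPf qa).
Qed.

(** The relation is only required in B(V), tested by all [evalD q s], so that each use reduces to an
    identity of scalars. *)
Lemma inL_lin u v : inL q u -> inL q v -> forall (c d : F) z,
  (forall s, evalD q s z = c * evalD q s u + d * evalD q s v) -> inL q z.
Proof.
move=> [l /eqBP El] [l' /eqBP El'] c d z E.
exists ([seq (c * p.1, p.2) | p <- l] ++ [seq (d * p.1, p.2) | p <- l']).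
apply/eqBP => s; rewrite E El El' /lincomb map_cat flatten_cat evalD_cat -!evalD_scale.
congr (_ + _); congr evalD; rewrite /scaleT map_flatten -!map_comp; congr flatten;
  by apply: eq_map => p; rewrite /scaleT /= -map_comp; apply: eq_map => r /=; rewrite mulrA.
Qed.

Lemma inL_letter a : inL q (mono [:: a]).
Proof. by exists [:: (1, BLeaf a)]; apply/eqBP => s; rewrite /lincomb /= mul1r. Qed.

Lemma inL_zero u : zeroB q u -> inL q u.
Proof. by move=> Zu; exists [::]; apply/eqBP => s; rewrite Zu evalD_nil. Qed.

Lemma evB_perm t p : p \in evB q t -> perm_eq p.2 (leaves t).
Proof.
elim: t p => [a|x IHx y IHy] p; first by rewrite inE => /eqP->.
rewrite mem_cat => /orP[/allpairsP[[r1 r2] /= [r1y r2x ->]]|/mapP[r + ->]] /=.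
  by rewrite perm_sym perm_catC perm_cat // perm_sym ?IHx ?IHy.
by move=> /allpairsP[[r1 r2] /= [r1x r2y ->]] /=; rewrite perm_cat ?IHx ?IHy.
Qed.

Lemma evalD_evB_perm s t : evalD q s (evB q t) != 0 -> perm_eq s (leaves t).
Proof.
rewrite evalDE; apply: contraR => nst; apply/eqP; rewrite /lext big_seq big1 // => p pt.
case: (eqVneq (pairing q s p.2) 0) => [->|]; first by rewrite mulr0.
by move=> /pairing_perm/perm_trans/(_ (evB_perm pt)); rewrite (negPf nst).
Qed.

Lemma evalD_lincomb s (l : seq (F * btree n)) :
  evalD q s (lincomb q l) = \sum_(p <- l) p.1 * evalD q s (evB q p.2).
Proof.
elim: l => [|p l IHl]; first by rewrite big_nil evalD_nil.
by rewrite big_cons -IHl -evalD_scale -evalD_cat.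
Qed.

Lemma inL_mono_homogeneous w : inL q (mono w) ->
  exists2 l, all (fun p => perm_eq (leaves p.2) w) l & eqB q (mono w) (lincomb q l).
Proof.
move=> [l /eqBP El]; exists [seq p <- l | perm_eq (leaves p.2) w]; first exact: filter_all.
apply/eqBP => s; rewrite !evalD_lincomb big_filter.
have [sw|nsw] := boolP (perm_eq s w).
  rewrite El evalD_lincomb (bigID (fun p => perm_eq (leaves p.2) w)) /=.
  rewrite [X in _ + X]big1 ?addr0 // => p npw.
  case: (eqVneq (evalD q s (evB q p.2)) 0) => [->|]; first by rewrite mulr0.
  by move=> /evalD_evB_perm sp; case/negP: npw; rewrite -(permPl sp).
rewrite big1 => [|p pw].
  by apply/eqP; apply: contraR nsw => /pairing_perm.
case: (eqVneq (evalD q s (evB q p.2)) 0) => [->|]; first by rewrite mulr0.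
by move=> /evalD_evB_perm/perm_trans/(_ pw); rewrite (negPf nsw).
Qed.

Lemma pairing_cat_lincomb l l' w x s : eqB q (mono w) (lincomb q l) ->
  eqB q (mono x) (lincomb q l') -> pairing q s (w ++ x)
  = \sum_(p <- l) \sum_(p' <- l') p.1 * p'.1 * evalD q s (mulT (evB q p.2) (evB q p'.2)).
Proof.
move=> Ew Ex; have := (eqBP _ _ _).1 (mulT_eqB Ew Ex) s; rewrite evalD_mulT !lext_mono => ->.
rewrite evalD_mulT; set g := fun w => _; transitivity (\sum_(p <- l) p.1 * lext (evB q p.2) g).
  rewrite /lincomb /lext; elim: l {Ew} => [|p l IHl]; rewrite ?big_nil // !big_cons -IHl.
  by rewrite [in LHS]/= big_cat big_map mulr_sumr; congr (_ + _); apply: eq_bigr => r _; rewrite mulrA.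
apply: eq_bigr => p _; rewrite {}/g exchange_lext.
set g := fun w => _.
transitivity (p.1 * \sum_(p' <- l') p'.1 * lext (evB q p'.2) g).
  congr (_ * _); rewrite /lincomb /lext; elim: l' {Ex} => [|r l' IHl]; rewrite ?big_nil // !big_cons -IHl.
  by rewrite [in LHS]/= big_cat big_map mulr_sumr; congr (_ + _); apply: eq_bigr => o _; rewrite mulrA.
rewrite mulr_sumr; apply: eq_bigr => r _; rewrite mulrA; congr (_ * _).
by rewrite evalD_mulT exchange_lext.
Qed.

Lemma eq_sum_all (T : Type) (P : pred T) (l : seq T) (f g : T -> F) :
  all P l -> (forall p, P p -> f p = g p) -> \sum_(p <- l) f p = \sum_(p <- l) g p.
Proof. by move=> /all_filterP <- E; rewrite !big_filter; apply: eq_bigr. Qed.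

(** In homogeneous expansions all pairs of trees share the coefficient chi(x, w), so the brackets of
    trees add up to the bracket of the words. *)
Lemma inL_bracket w x : inL q (mono w) -> inL q (mono x) ->
  inL q [:: (1, x ++ w); (- chiw q x w, w ++ x)].
Proof.
move=> /inL_mono_homogeneous[l lw Ew] /inL_mono_homogeneous[l' lx Ex].
exists [seq (p.1 * p'.1, BNode p.2 p'.2) | p <- l, p' <- l'].
apply/eqBP => s; rewrite evalD_lincomb evalDE /lext big_cons big_seq1 /= mul1r mulNr.
rewrite (pairing_cat_lincomb s Ew Ex) (pairing_cat_lincomb s Ex Ew) exchange_big /=.
rewrite big_allpairs_dep mulr_sumr -sumrN -big_split /=.
apply: (eq_sum_all lw) => p pw; rewrite mulr_sumr -sumrN -big_split /=.
apply: (eq_sum_all lx) => r rx; rewrite evalD_cat evalD_scale (chiw_perm rx pw); ring.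
Qed.

Lemma evalD2 s (c d : F) w x :
  evalD q s [:: (c, w); (d, x)] = c * pairing q s w + d * pairing q s x.
Proof. by rewrite evalDE /lext big_cons big_seq1. Qed.

Lemma inL_catC w x : inL q (mono w) -> inL q (mono x) ->
  inL q (mono (w ++ x)) -> inL q (mono (x ++ w)).
Proof.
move=> Lw Lx Lwx; apply: (inL_lin (inL_bracket Lw Lx) Lwx (c := 1) (d := chiw q x w)) => s.
rewrite evalD2 -!/(pairing _ _ _); ring.
Qed.

Lemma inL_cat w x : inL q (mono w) -> inL q (mono x) ->
  chiw q w x * chiw q x w != 1 -> inL q (mono (w ++ x)).
Proof.
rewrite -subr_eq0 => Lw Lx nz.
(* The coefficients eliminate [x ++ w] from the two brackets. *)
apply: (inL_lin (inL_bracket Lw Lx) (inL_bracket Lx Lw)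
  (c := - chiw q w x / (chiw q w x * chiw q x w - 1))
  (d := - (chiw q w x * chiw q x w - 1)^-1)) => s.
by rewrite !evalD2 -!/(pairing _ _ _); field.
Qed.

(* Moving [c a] past [y] in one block and letter by letter yields two scalars whose ratio is q_ac q_ca *)
Lemma inL_pair a c y : ~~ qtriv q a c -> inL q (mono y) -> inL q (mono [:: c; a]) ->
  inL q (mono (a :: y)) -> inL q (mono (rcons y c)) -> inL q (mono (y ++ [:: c; a])).
Proof.
rewrite /qtriv -subr_eq0 -cats1 => nac Ly Lca Lay Lyc.
have La := inL_letter a; have Lc := inL_letter c.
pose k := chiw q [:: c] y * chiw q [:: a] y.
pose N := q a c * q c a - 1.
(* Letter by letter: y c a to a y c to c a y. The middle word cancels. *)
have H := inL_lin (inL_bracket Lay Lc) (inL_bracket Lyc La)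
  (c := 1) (d := chiw q [:: c] (a :: y))
  (z := [:: (1, c :: a :: y); (- (chiw q [:: c] (a :: y) * chiw q [:: a] (y ++ [:: c])), (y ++ [:: c]) ++ [:: a])]).
(* [H] minus the block bracket is -kN times y c a. *)
apply: (inL_lin (H _) (inL_bracket Ly Lca) (c := - (k * N)^-1) (d := (k * N)^-1)) => s.
  by rewrite !evalD2 /=; ring.
rewrite !evalD2 -catA /= -/(pairing _ _ _).
rewrite -(cat1s a y) !chiw_catr !chiw11 (chiw_cons c [:: a]) /k /N; field.
by rewrite nac !chiw_neq0.
Qed.

Lemma inL_move x y w a : all (qtriv q a) w ->
  inL q (mono (x ++ w ++ a :: y)) <-> inL q (mono (x ++ a :: w ++ y)).
Proof.
move=> taw; split=> L.
  apply: (inL_lin L L (c := (chiw q w [:: a])^-1) (d := 0)) => s.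
  by rewrite -!/(pairing _ _ _) (pairing_move x y s taw) mulKf ?chiw_neq0 // mul0r addr0.
apply: (inL_lin L L (c := chiw q w [:: a]) (d := 0)) => s.
by rewrite -!/(pairing _ _ _) (pairing_move x y s taw) mul0r addr0.
Qed.
End BraidedLie.

(** * Connected words *)

Section Connectivity.
Variables (F : fieldType) (n : nat) (q : 'I_n -> 'I_n -> F).
Implicit Types (w x y : word n) (a b c d e : 'I_n).

Lemma gamma_on_sym w : symmetric (gamma_on q w).
Proof.
by move=> a b; rewrite /gamma_on eq_sym mulrC; case: (a \in w); case: (b \in w).
Qed.

(** Cut form of connectedness with base point [e]. As [B] separates a from b, they are distinct and
    form an edge. *)
Lemma connected_wordP e w : e \in w ->
  connected_word q w <->
  (forall B : pred 'I_n, ~~ B e -> has B w ->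
    exists a b, [/\ a \in w, b \in w, B a, ~~ B b & ~~ qtriv q a b]).
Proof.
move=> ew; split=> [C B nBe /hasP[a aw Ba]|C].
  have [/existsP[a' /existsP[b /and5P[]]]|nex] := boolP [exists a, exists b,
    [&& a \in w, b \in w, B a, ~~ B b & ~~ qtriv q a b]]; first by exists a', b.
  have cl : closed (gamma_on q w) B.
    apply: (intro_closed (sym_connect_sym (gamma_on_sym w))) => x y /and4P[xw yw _ nxy] Bx.
    apply: contraR nex => nBy; apply/existsP; exists x; apply/existsP; exists y.
    by rewrite xw yw nxy -!/(B _) [B x]Bx andbT.
  have := closed_connect cl (implyP (implyP (forallP (forallP C e) a) ew) aw).
  by rewrite /in_mem /= Ba (negPf nBe).
suff E a : a \in w -> connect (gamma_on q w) e a.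
  apply/forallP=> a; apply/forallP=> b; apply/implyP=> /E ea; apply/implyP=> /E.
  by apply: connect_trans; rewrite (sym_connect_sym (gamma_on_sym w)).
move=> aw; apply: contraT => nea.
(* The cut taken is the complement of the component of [e]. *)
have [||x [y [xw yw /= nex]]] := C (predC (connect (gamma_on q w) e)).
- by rewrite /= connect0.
- by apply/hasP; exists a.
rewrite negbK => ey nxy; have yx: y != x by apply: contraNneq nex => <-.
case/negP: nex; apply: connect_trans ey (connect1 _).
by rewrite gamma_on_sym /gamma_on xw yw eq_sym yx.
Qed.

Lemma eq_connected_word w w' : w =i w' -> connected_word q w = connected_word q w'.
Proof.
move=> E; rewrite /connected_word; apply: eq_forallb => a; apply: eq_forallb => b.
by rewrite !E; congr (_ ==> (_ ==> _)); apply: eq_connect => x y; rewrite /gamma_on !E.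
Qed.

Lemma connected_word1 a : connected_word q [:: a].
Proof.
apply/(@connected_wordP a) => [|B nBa]; first exact: mem_head.
by rewrite has_seq1 (negPf nBa).
Qed.

Lemma disconnected_wordP w : ~~ connected_word q w ->
  exists A : pred 'I_n, [/\ has A w, has (predC A) w
    & forall a b, a \in w -> b \in w -> A a -> ~~ A b -> qtriv q a b].
Proof.
move=> /forallPn[a /forallPn[b]]; rewrite !negb_imply => /and3P[aw bw nab].
exists (connect (gamma_on q w) a); split.
- by apply/hasP; exists a; rewrite ?connect0.
- by apply/hasP; exists b.
move=> x y xw yw ax; apply: contraR => nxy.
case: (eqVneq x y) => [<- //|xy].
by apply: connect_trans ax (connect1 _); rewrite /gamma_on xw yw xy.
Qed.

Lemma connected_attach a w : connected_word q w -> ~~ all (qtriv q a) w ->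
  connected_word q (a :: w).
Proof.
move=> C /allPn[e ew nae].
have ew' : e \in a :: w by rewrite inE ew orbT.
apply/(connected_wordP ew') => B nBe /=.
case: (boolP (B a)) => [Ba _|_ /=]; first by exists a, e; rewrite mem_head ew'.
by move=> /((connected_wordP ew).1 C B nBe)[x [y [xw yw *]]]; exists x, y; rewrite !inE xw yw !orbT.
Qed.

(** Transports a letter removed from the subword of letters in [A] back to its place in [w]. *)
Lemma filter_eq_cat (A : pred 'I_n) w x d y : filter A w = x ++ d :: y ->
  exists x' y', [/\ w = x' ++ d :: y', filter A x' = x & filter A y' = y].
Proof.
elim: w x => [|b w IHw] x /=; first by case: x.
case: ifP => Ab.
  case: x => [[<- <-]|b' x [<- /IHw[x' [y' [-> <- <-]]]]]; first by exists [::], w.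
  by exists (b :: x'), y'; rewrite /= Ab.
by move=> /IHw[x' [y' [-> <- <-]]]; exists (b :: x'), y'; rewrite /= Ab.
Qed.

(* If the last letter [e] is a cut vertex, let [A] be a side of the cut avoiding [c]:
   letters of [A] only interact with [A] and [e], so one recurses into the shorter
   word formed by [e] and the letters of [A], read backwards. *)
Lemma connected_remove c w : w != [::] -> connected_word q (c :: w) ->
  exists x d y, [/\ w = x ++ d :: y, connected_word q (c :: x ++ y)
    & all (qtriv q d) (c :: x) || all (qtriv q d) y].
Proof.
have [m] := ubnP (size w); elim: m c w => // m IHm c w sw w0 C.
case/lastP: w w0 sw C => // w e _; rewrite size_rcons ltnS => sw C.
have [Cv|/disconnected_wordP[A0 [hA hnA cut]]] := boolP (connected_word q (c :: w)).
  by exists w, e, [::]; rewrite cats1 cats0 orbT.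
(* Complementing if necessary, the side [A] of the cut avoids [c]. *)
have {A0 hA hnA cut} [A [nAc hA cut]] : exists A : pred 'I_n, [/\ ~~ A c, has A w
    & forall a b, a \in c :: w -> b \in c :: w -> A a -> ~~ A b -> qtriv q a b].
  case: (boolP (A0 c)) => Ac.
    exists (predC A0); split; rewrite /= ?Ac //; first by move: hnA; rewrite /= Ac.
    by move=> a b aw bw nAa; rewrite negbK qtriv_sym => Ab; apply: cut.
  by exists A0; split=> //; move: hA; rewrite /= (negPf Ac).
have ew : e \in c :: rcons w e by rewrite inE mem_rcons mem_head orbT.
have Cut := (connected_wordP ew).1 C.
have inw a : a \in c :: rcons w e -> a = e \/ a \in c :: w.
  by rewrite !inE mem_rcons inE orbCA => /orP[/eqP|]; [left|right].
(* An edge leaving the intersection of [A] and [B] ends in [e] or in [A], because letters of [A]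
   commute with the rest of [c :: w]. *)
have Cu : connected_word q (e :: rev (filter A w)).
  apply/(@connected_wordP e) => [|B nBe]; first exact: mem_head.
  rewrite /= (negPf nBe) has_rev => /hasP[a]; rewrite mem_filter => /andP[Aa aw] Ba.
  have [||x [y [xw yw /andP[Ax Bx]]]] := Cut (predI A B).
  - by rewrite /= (negPf nBe) andbF.
  - by apply/hasP; exists a; rewrite /= ?Aa // inE mem_rcons inE aw !orbT.
  case: (inw x xw) => [xe|{}xw]; first by rewrite xe (negPf nBe) in Bx.
  have xu : x \in filter A w.
    by move: xw; rewrite mem_filter Ax inE; case: eqP Ax nAc => // -> ->.
  case: (inw y yw) => [-> _|{}yw] /=.
    by move=> nxe; exists x, e; rewrite mem_head inE mem_rev xu orbT.
  rewrite negb_and => /orP[nAy|nBy] nxy.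
    by case/negP: nxy; apply: cut.
  have Ay : A y by apply: contraR nxy; apply: cut.
  exists x, y; split=> //; rewrite inE mem_rev ?xu ?orbT // mem_filter Ay.
  by move: yw; rewrite inE; case: eqP Ay nAc => [-> ->|_ _ _ /= ->]; rewrite ?orbT.
(* [e] takes the role of [c]; the reversal puts the letters to the right of [d] in [w] next to
   [e]. *)
have [||x [d [y [Eu Cd comm]]]] := IHm e (rev (filter A w)) _ _ Cu.
- by rewrite size_rev size_filter (leq_ltn_trans (count_size _ _)).
- by rewrite -size_eq0 size_rev size_filter -lt0n -has_count.
have {Eu} : filter A w = rev y ++ d :: rev x.
  by rewrite -[LHS]revK Eu rev_cat rev_cons cat_rcons.
move=> /[dup] Eu /filter_eq_cat[y' [x' [Ew Ey Ex]]].
have [Ad dw] : A d /\ d \in w.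
  by apply/andP; rewrite -mem_filter Eu mem_cat mem_head orbT.
(* [d] lies in [A], so it commutes with all letters of [c :: w] outside [A]. *)
have triv_w z : {subset z <= c :: w} -> all (qtriv q d) (filter A z) -> all (qtriv q d) z.
  move=> zw /allP tz; apply/allP => b bz; case: (boolP (A b)) => Ab.
    by apply: tz; rewrite mem_filter Ab.
  by apply: cut (zw b bz) Ad Ab; rewrite inE dw orbT.
have sub_y : {subset c :: y' <= c :: w}.
  by move=> b; rewrite Ew !inE mem_cat => /orP[->|->]; rewrite ?orbT.
have sub_x : {subset x' <= c :: w} by move=> b bx; rewrite Ew !(inE, mem_cat) bx !orbT.
exists y', d, (rcons x' e); split; first by rewrite Ew rcons_cat rcons_cons.
  set wo := c :: y' ++ rcons x' e.
  have ewo : e \in wo by rewrite inE mem_cat mem_rcons mem_head !orbT.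
  have wo_in b : b \in c :: w -> b != d -> b \in wo.
    rewrite Ew /wo !(inE, mem_cat, mem_rcons) => /or4P[] -> //; rewrite ?orbT //.
  have in_wo b : b \in wo -> b = e \/ b \in c :: w.
    move=> bwo; apply: inw; move: bwo; rewrite Ew /wo !(inE, mem_cat, mem_rcons).
    by case/or4P=> ->; rewrite ?orbT.
  have sub_e : {subset e :: x ++ y <= wo}.
    move=> b; rewrite inE => /orP[/eqP->//|]; rewrite mem_cat -(mem_rev x) -(mem_rev y) -Ex -Ey.
    rewrite !mem_filter /wo !(inE, mem_cat, mem_rcons) => /orP[]/andP[_ ->]; rewrite ?orbT //.
  (* If the given letter [a] of [B] is in [A], an edge leaving [B] comes from the shrunken word of
     [e] and letters of [A]; otherwise from the cut of the full word by [B] minus [A]. *)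
  apply/(connected_wordP ewo) => B nBe /hasP[a awo Ba].
  case: (boolP (A a)) => Aa.
    have ea : a != e by apply: contraNneq nBe => <-.
    have ae : a \in e :: x ++ y.
      move: awo; rewrite /wo !(inE, mem_cat, mem_rcons) (negPf ea) /=.
      case/or3P=> [/eqP ac|ay|ax]; first by rewrite -ac Aa in nAc.
        by rewrite -(mem_rev y) -Ey mem_filter Aa ay orbT.
      by rewrite -(mem_rev x) -Ex mem_filter Aa ax.
    have [|x1 [y1 [/sub_e ? /sub_e ? *]]] := (connected_wordP (mem_head e _)).1 Cd B nBe.
      by apply/hasP; exists a.
    by exists x1, y1.
  have [||x1 [y1 [x1w y1w /= /andP[nAx Bx]]]] := Cut (predI (predC A) B).
  - by rewrite /= (negPf nBe) andbF.
  - apply/hasP; exists a; rewrite /= ?Aa //.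
    by case: (in_wo a awo) => [-> //|]; rewrite !inE mem_rcons inE => /orP[]->; rewrite ?orbT.
  have {}x1w : x1 \in c :: w by case: (inw x1 x1w) => // xe; rewrite xe (negPf nBe) in Bx.
  have x1d : x1 != d by apply: contraNneq nAx => ->.
  case: (inw y1 y1w) => [-> _|{}y1w] nxy; first by exists x1, e; rewrite wo_in.
  case: (boolP (A y1)) nxy => Ay /= nxy trxy.
    by case/negP: trxy; rewrite qtriv_sym; apply: cut.
  by exists x1, y1; rewrite !wo_in //; apply: contraNneq Ay => ->.
case/orP: comm => /allP td; apply/orP; [right|left].
  rewrite all_rcons td ?mem_head // triv_w // Ex; apply/allP => b; rewrite mem_rev => bx.
  by apply: td; rewrite inE bx orbT.
apply: triv_w => //=; rewrite (negPf nAc) Ey.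
by apply/allP => b; rewrite mem_rev; apply: td.
Qed.

(** Besides disconnected words, this excludes the powers x_a^k with k > 1 and q_aa = 1. *)
Definition good_word w :=
  connected_word q w /\ (forall a, (1 < size w)%N -> all (pred1 a) w -> q a a != 1).

Lemma eq_good_word w w' : perm_eq w w' -> good_word w -> good_word w'.
Proof.
move=> p [C nq]; split; first by rewrite -(eq_connected_word (perm_mem p)).
by move=> a; rewrite -(perm_size p) -(perm_all _ p); apply: nq.
Qed.

Lemma good_word1 a : good_word [:: a].
Proof. by split; first exact: connected_word1. Qed.

Lemma good_remove w : (1 < size w)%N -> good_word w ->
  exists x d y, [/\ w = x ++ d :: y, good_word (x ++ y)
    & all (qtriv q d) x || all (qtriv q d) y].
Proof.
case: w => // b w sw [C nq].
have w0 : w != [::] by case: (w) sw.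
have [x [d [y [Ew Cd comm]]]] := connected_remove w0 C.
have [|ok] := boolP [&& (0 < size (x ++ y))%N, all (pred1 b) (x ++ y) & q b b == 1].
  (* Here deleting [d] would leave a power of [b] with q_bb = 1. Deleting the first [b] instead does
     not change the set of letters. *)
  case/and3P=> s0 xyb /eqP qb; exists [::], b, w; split=> //=.
  have bxy : b \in x ++ y by case: (x ++ y) s0 xyb => // b' z _ /andP[/eqP<-]; rewrite mem_head.
  have bw : b \in w by move: bxy; rewrite Ew !mem_cat inE => /orP[]->; rewrite ?orbT.
  split=> [|a sw' /allP wa].
    by rewrite -(@eq_connected_word (b :: w)) // => e; rewrite inE; case: eqP => // ->; rewrite bw.
  by apply: (nq a) => //; apply/andP; split; [apply: wa | apply/allP].
exists (b :: x), d, y; split; rewrite ?Ew //; split=> // a /= s0 /andP[/eqP ba xya].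
move: ok; rewrite (s0 : (0 < size (x ++ y))%N) (eq_all (a2 := pred1 a)) ?xya //; last by move=> e; rewrite /= ba.
by rewrite ba.
Qed.
End Connectivity.

(** * Connected monomials lie in L(V) *)

(* [lia] preprocesses every hypothesis in sight, which is very slow here, hence the [clear]. *)
Ltac perm_count :=
  apply/seq.permP => ?; rewrite /=; do ! rewrite count_cat /=;
  repeat match goal with H : ?P |- _ => match type of P with Prop => clear H end end; lia.

Section ConnectedMonomials.
Variables (F : fieldType) (n : nat) (q : 'I_n -> 'I_n -> F).
Hypothesis q_neq0 : forall i j, q i j != 0.
Implicit Types (h s u w x y z : word n) (a b c d e : 'I_n).

Local Notation L w := (inL q (mono w)).

Lemma connected_neighbor a w : connected_word q w -> a \in w -> ~~ all (pred1 a) w ->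
  exists2 b, b \in w & (b != a) && ~~ qtriv q a b.
Proof.
move=> C aw na; have [||b [c [bw cw /= nba]]] := (connected_wordP q aw).1 C (predC1 a).
- by rewrite /= eqxx.
- by rewrite has_predC.
by rewrite negbK => /eqP-> nt; exists b; rewrite // nba qtriv_sym.
Qed.

(** A letter a of [u] attached to [w] contributes an edge, or shows that q_aa^2 is not 1 if only one
    letter occurs. *)
Lemma good_cat u w : good_word q w -> {in u, forall a, ~~ all (qtriv q a) w} ->
  good_word q (u ++ w).
Proof.
move=> [C nq] att; split.
  elim: u att => //= a u IHu att; apply: connected_attach.
    by apply: IHu => b bu; apply: att; rewrite inE bu orbT.
  by rewrite all_cat negb_and att ?orbT // mem_head.
move=> b; case: u att => [_|a u att _ /= /andP[/eqP ab]]; first exact: nq.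
rewrite all_cat => /andP[_ /allP wb]; have /allPn[e /wb/eqP-> nab] := att a (mem_head _ _).
by apply: contra nab => /eqP qb; rewrite /qtriv ab qb mulr1.
Qed.

Lemma chiw_triv a w : all (qtriv q a) w -> chiw q [:: a] w * chiw q w [:: a] = 1.
Proof.
elim: w => [|b w IHw] /=; first by rewrite /chiw big_seq1 !big_nil mulr1.
case/andP=> /eqP tab /IHw E.
rewrite (chiw_cons q b w) -(cat1s b w) chiw_catr !chiw11 -[RHS]E -[RHS]mul1r -tab; ring.
Qed.

(** As x w = w x, the bracket equals (1 - chi(x, w)) w x. *)
Lemma inL_cat_comm w x : w ++ x = x ++ w -> chiw q x w != 1 -> L w -> L x -> L (w ++ x).
Proof.
rewrite -subr_eq0 => E nz Lw Lx; have Lb := inL_bracket Lw Lx.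
apply: (inL_lin Lb Lb (c := - (chiw q x w - 1)^-1) (d := 0)) => s.
by rewrite evalD2 -E -!/(pairing _ _ _); field.
Qed.

(* One of the brackets of [a ^ m.+1] with [a] and of [a ^ m] with [a ^ 2] has a nonzero
   coefficient unless [q a a = -1], in which case [a ^ 2 = 0]. *)
Lemma inL_power a m : q a a != 1 -> L (nseq m.+1 a).
Proof.
move=> qa; have [k] := ubnP m; elim: k m => // k IHk [|m] km; first exact: inL_letter.
have chiE i j : chiw q (nseq i a) (nseq j a) = q a a ^+ (i * j).
  by rewrite /chiw !big_nseq !iter_mulr_1 -exprM mulnC.
have nC i j : nseq i a ++ nseq j a = nseq j a ++ nseq i a by rewrite !cat_nseq /ncons -!iterD addnC.
have [q1|q1] := eqVneq (q a a ^+ m.+1) 1; last first.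
  apply: (inL_cat_comm (w := [:: a]) (x := nseq m.+1 a)); first exact: (nC 1%N).
  - by rewrite (chiE _ 1%N) muln1.
  - exact: inL_letter.
  exact: IHk.
have [q2|q2] := eqVneq (q a a ^+ 2) 1.
  by apply: inL_zero => s; apply: (@pairing_sq _ _ _ [::]); rewrite // /qtriv -expr2 q2.
case: m km q1 => [|m] km q1; first by rewrite -(expr1 (q a a)) q1 eqxx in qa.
apply: (inL_cat_comm (w := [:: a; a]) (x := nseq m.+1 a)); first exact: (nC 2%N).
(* Otherwise the powers of q_aa with exponents 2(m+1) and 2(m+2) are both 1, whence q_aa^2 = 1. *)
- rewrite (chiE _ 2%N) mulnC; apply: contraNneq q2 => q3.
  by apply/eqP; rewrite -[LHS]mulr1 -{1}q3 -exprD -mulnS mulnC exprM q1 expr1n.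
- by apply: (IHk 1%N); lia.
by apply: IHk; lia.
Qed.

(** * The induction step for words in at least two distinct letters *)

Section Degree.
Variable h : word n.
Hypothesis IHh : forall w, (size w < size h)%N -> w != [::] -> good_word q w -> L w.
Hypothesis h_conn : connected_word q h.
Hypothesis h_size : (1 < size h)%N.
Hypothesis h_multi : forall a, ~~ all (pred1 a) h.

(** Stated for all rearrangements, since below [h] matters only as a multidegree. *)
Definition removable a := forall y, perm_eq (a :: y) h -> good_word q y.

Lemma inL_removable a y : removable a -> perm_eq (a :: y) h -> L y.
Proof.
move=> ra p; have sz := perm_size p; apply: IHh; last exact: ra.
  by rewrite -sz.
by move: sz h_size; rewrite -size_eq0 -lt0n /= => <-.
Qed.

(** The letters of [z] are rotated one at a time, each past a shorter word that lies in L(V) by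
    removability. *)
Lemma inL_rot z y : {in z, forall a, removable a} -> perm_eq (z ++ y) h ->
  L (z ++ y) <-> L (y ++ z).
Proof.
elim: z y => [|a z IHz] y rz p; first by rewrite cats0.
have Lzy := inL_removable (rz a (mem_head _ _)) p.
have <- : (y ++ [:: a]) ++ z = y ++ a :: z by rewrite -catA.
rewrite -IHz => [|b bz|].
- rewrite catA; split; [apply: (inL_catC (w := [:: a]))|apply: inL_catC] => //; exact: inL_letter.
- by apply: rz; rewrite inE bz orbT.
by rewrite catA cats1 perm_rcons.
Qed.

(** The words that [inL_pair] requires are all shorter than [h]; for [[:: c; a]] this takes [y]
    nonempty. *)
Lemma inL_pair_removable a c y : ~~ qtriv q a c -> removable a -> removable c ->
  y != [::] -> good_word q y -> perm_eq (a :: c :: y) h -> L (y ++ [:: c; a]).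
Proof.
move=> nac ra rc y0 gy p; have sh := perm_size p.
have p' : perm_eq (c :: a :: y) h by rewrite -(permPr p) -(perm_catCA [:: a] [:: c] y).
apply: (inL_pair q_neq0) => //.
- by apply: IHh; rewrite // -sh ltnW.
- apply: IHh => //; first by rewrite -sh /= !ltnS lt0n size_eq0.
  apply: (good_cat (u := [:: c]) (good_word1 q a)) => b; rewrite inE => /eqP->.
  by rewrite /= qtriv_sym andbT.
- exact: inL_removable rc p'.
by apply: (inL_removable ra); rewrite (perm_trans _ p) // perm_cons perm_rcons.
Qed.

(* [u] collects letters already removed from the word; [w] is what remains. *)
Lemma inL_split u w : perm_eq (u ++ w) h -> w != [::] -> good_word q w ->
  {in u, forall a, removable a} -> pairwise (qtriv q) u -> L (u ++ w).
Proof.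
have [m] := ubnP (size w); elim: m u w => // m IHm u w sw p w0 gw ru pu.
have triv_u u1 a u2 : u = u1 ++ a :: u2 -> all (qtriv q a) u1 /\ all (qtriv q a) u2.
  move=> Eu; move: pu; rewrite Eu pairwise_cat allrel_consr /= => /and3P[/andP[/allP u1a _] _].
  by case/andP=> ? _; split=> //; apply/allP => b /u1a; rewrite qtriv_sym.
have split_u a : a \in u -> exists u1 u2, u = u1 ++ a :: u2.
  by move=> /splitPr[u1 u2]; exists u1, u2.
(* If [w] is a single letter, [x ++ y] is empty, hence the guard on its goodness. *)
have [x [c [y [Ew gxy comm]]]] : exists x c y, [/\ w = x ++ c :: y,
    x ++ y != [::] -> good_word q (x ++ y) & all (qtriv q c) x || all (qtriv q c) y].
  case: (ltnP 1 (size w)) => [/good_remove/(_ gw)[x [c [y [? ? ?]]]]|]; first by exists x, c, y.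
  by case: (w) w0 => [|c [|]] // _ _; exists [::], c, [::].
(* A letter [a] of [u] that commutes with [x ++ y] has [c] as its only neighbour. The two scalars
   between [a] and the remaining word then multiply to q_ac q_ca, which is not 1. *)
have [/hasP[a au ta]|] := boolP (has (fun a => all (qtriv q a) (x ++ y)) u).
  have [u1 [u2 Eu]] := split_u a au; have [ta1 ta2] := triv_u _ _ _ Eu.
  have tz : all (qtriv q a) (u1 ++ u2 ++ x ++ y) by rewrite all_cat ta1 all_cat ta2.
  have pz : perm_eq (u1 ++ u2 ++ w) (c :: u1 ++ u2 ++ x ++ y).
    by rewrite Ew !catA perm_catC /= perm_cons perm_catC -!catA.
  have pa : perm_eq (a :: u1 ++ u2 ++ w) h.
    by rewrite -(permPr p) Eu -!catA /= perm_sym -(perm_catCA [:: a] u1).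
  have nac : ~~ qtriv q a c.
    have ah : a \in h by rewrite -(perm_mem pa) mem_head.
    have [b] := connected_neighbor h_conn ah (h_multi a).
    rewrite -(perm_mem pa) inE (perm_mem pz) inE => /or3P[/eqP->|/eqP->|bz] /andP[nab].
    - by rewrite eqxx in nab.
    - by [].
    by rewrite (allP tz).
  rewrite Eu -catA /=; apply/(inL_move q_neq0 [::] _ ta1) => /=.
  apply: (inL_cat (w := [:: a])); [exact: inL_letter | exact: inL_removable (ru a au) pa |].
  rewrite (chiw_perm q (perm_refl [:: a]) pz) (chiw_perm q pz (perm_refl [:: a])).
  rewrite (chiw_cons q c) -(cat1s c) chiw_catr !chiw11.
  by rewrite mulrACA chiw_triv // mulr1.
rewrite -all_predC => /allP att.
(* With an empty [x ++ y] the case just excluded would cover every letter of [u], so [u] would be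
   empty and [h] a single letter. *)
have xy0 : x ++ y != [::].
  apply: contraTneq h_size => xy0; rewrite -(perm_size p) Ew.
  have -> : u = [::] by case: (u) att => // a u' /(_ a (mem_head _ _)); rewrite /= xy0.
  by rewrite cat0s size_cat addnS -size_cat xy0.
move/(_ xy0): gxy => gxy.
have gu u' : {subset u' <= u} -> good_word q (u' ++ x ++ y).
  by move=> su; apply: good_cat => // a /su; apply: att.
have pc : perm_eq (c :: u ++ x ++ y) h.
  by rewrite -(permPr p) Ew !catA perm_sym perm_catC /= perm_cons perm_catC.
have rc : removable c.
  move=> z pz; apply: eq_good_word (gu u _) => //.
  by rewrite -(perm_cons c) (permPl pc) perm_sym.
(* If some [a] in [u] does not commute with [c], commutations and rotations bring the two together
   at the end, where [inL_pair_removable] applies. *)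
have [/hasP[a au nac]|] := boolP (has (fun a => ~~ qtriv q a c) u).
  have [u1 [u2 Eu]] := split_u a au; have [ta1 ta2] := triv_u _ _ _ Eu.
  have su' : {subset u1 ++ u2 <= u}.
    by move=> b; rewrite Eu !mem_cat inE => /orP[]->; rewrite ?orbT.
  have ru' : {in u1 ++ u2, forall b, removable b} by move=> b /su'; apply: ru.
  have y0 z z' : (z ++ (x ++ y)) ++ z' != [::].
    by move: xy0; case: (x ++ y) => // b e _; rewrite -size_eq0 !size_cat /= addnS.
  have pv z : perm_eq z (c :: u ++ x ++ y) -> perm_eq z h by move/permPl->.
  case/orP: comm => tc.
    have H : L (((x ++ y) ++ u1 ++ u2) ++ [:: a; c]).
      apply: inL_pair_removable => //; first by rewrite qtriv_sym.
      - exact: ru.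
      - exact: (y0 [::]).
      - by apply: eq_good_word (gu _ su'); perm_count.
      by apply: pv; rewrite Eu; perm_count.
    rewrite Eu Ew; apply/(inL_move q_neq0 _ y tc); rewrite -catA.
    apply/(inL_move q_neq0 u1 (c :: x ++ y) ta2); rewrite catA.
    apply/inL_rot => //; first by apply: pv; rewrite Eu; perm_count.
    rewrite -[X in L X]/([:: a; c] ++ _); apply/inL_rot => //.
      by move=> b; rewrite !inE => /orP[]/eqP-> //; apply: ru.
    by apply: pv; rewrite Eu; perm_count.
  have H : L (((u1 ++ u2) ++ x ++ y) ++ [:: c; a]).
    apply: inL_pair_removable => //.
    - exact: ru.
    - by rewrite -[X in X != _]cats0.
    - exact: gu.
    by apply: pv; rewrite Eu; perm_count.
  apply/inL_rot => //; rewrite Eu Ew -catA /=; apply/(inL_move q_neq0 x _ tc).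
  have -> : x ++ y ++ c :: u1 ++ a :: u2 = ((x ++ y) ++ [:: c]) ++ u1 ++ a :: u2.
    by rewrite -!catA.
  apply/(inL_move q_neq0 _ u2 ta1).
  have -> : ((x ++ y) ++ [:: c]) ++ a :: u1 ++ u2 = ((x ++ y) ++ [:: c; a]) ++ u1 ++ u2.
    by rewrite -!catA.
  apply/(inL_rot (z := u1 ++ u2)) => //; last by rewrite catA.
  by apply: pv; rewrite Eu; perm_count.
rewrite -all_predC => tcu.
have tcu' : all (qtriv q c) u by apply: sub_all tcu => a /=; rewrite negbK qtriv_sym.
(* Otherwise [c] joins the collected letters. *)
have Lc : L ((c :: u) ++ x ++ y).
  apply: IHm => //=; last by rewrite tcu'.
    by move: sw; rewrite Ew !size_cat addnS.
  by move=> a; rewrite inE => /orP[/eqP->|/ru].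
case/orP: comm => tc.
  rewrite Ew; apply/(inL_move q_neq0 u y tc).
  exact/(inL_move q_neq0 [::] (x ++ y) tcu').
apply/inL_rot => //; rewrite Ew -catA /=; apply/(inL_move q_neq0 x u tc).
rewrite catA; apply/(inL_rot (z := c :: u)) => //.
by move=> a; rewrite inE => /orP[/eqP->|/ru].
Qed.
End Degree.

Lemma inL_good w : w != [::] -> good_word q w -> L w.
Proof.
have [k] := ubnP (size w); elim: k w => // k IHk w; rewrite ltnS => sw w0 gw.
have [nw|] := boolP [forall a, ~~ all (pred1 a) w].
  have sw1 : (1 < size w)%N.
    by case: w w0 nw {sw gw} => [|a [|b w]] // _ /forallP/(_ a); rewrite /= eqxx.
  apply: (@inL_split w _ gw.1 sw1 (forallP nw) [::]) => //.
  by move=> x xw; apply: IHk; apply: leq_trans sw.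
rewrite negb_forall => /existsP[a /negPn wa].
case: w w0 sw gw wa => [|b [|c w]] // _ _ [_ nq] wa.
  exact: inL_letter.
by rewrite (all_pred1P _ _ wa); apply: inL_power; apply: nq.
Qed.

(** * Vanishing of disconnected monomials in L(V) *)

Lemma pairing_swap_words x y y' s : allrel (qtriv q) y y' ->
  pairing q s (x ++ y ++ y') = chiw q y y' * pairing q s (x ++ y' ++ y).
Proof.
elim: y' x => [|a y' IHy] x.
  by rewrite cats0 /chiw big1 ?mul1r // => a _; rewrite big_nil.
rewrite allrel_consr => /andP[ya yy'].
rewrite pairing_move; last by apply: sub_all ya => b; rewrite qtriv_sym.
have := IHy (rcons x a) yy'; rewrite !cat_rcons => ->.
by rewrite mulrA -chiw_catr.
Qed.

Lemma zeroB_add (u v : tv F n) (k : F) : zeroB q u -> zeroB q v -> zeroB q (addT u (scaleT k v)).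
Proof. by move=> Zu Zv s; rewrite evalD_cat evalD_scale Zu Zv mulr0 addr0. Qed.

Lemma zeroB_mulTl (u v : tv F n) : zeroB q u -> zeroB q (mulT u v).
Proof.
move=> Zu s; rewrite evalD_mulT exchange_lext /lext big1 // => p _.
by have := zeroB_ctx [::] p.2 Zu s; rewrite /lext /= => ->; rewrite mulr0.
Qed.

Lemma zeroB_mulTr (u v : tv F n) : zeroB q v -> zeroB q (mulT u v).
Proof.
move=> Zv s; rewrite evalD_mulT /lext big1 // => p _.
have := zeroB_ctx p.2 [::] Zv s; under eq_lext do rewrite cats0.
by rewrite /lext => ->; rewrite mulr0.
Qed.

(** The two factors commute up to exactly the scalar that the bracket subtracts. *)
Lemma evB_node_zero (t t' : btree n) :
  allrel (qtriv q) (leaves t') (leaves t) -> zeroB q (evB q (BNode t t')).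
Proof.
move=> /allrelP tt s; rewrite evalD_cat evalD_scale !evalD_mulT exchange_lext.
rewrite /lext mulr_sumr -big_split /= big_seq big1 // => p pt.
rewrite !mulr_sumr -big_split /= big_seq big1 // => r rt.
have pE := evB_perm pt; have rE := evB_perm rt.
have := @pairing_swap_words [::] r.2 p.2 s; rewrite /= => ->.
  rewrite (chiw_perm q rE pE); ring.
by apply/allrelP => a b; rewrite (perm_mem pE) (perm_mem rE); apply: tt.
Qed.

(** Either a child meets both sides of the cut and vanishes by induction, or the children lie on
    opposite sides and the outermost bracket vanishes. *)
Lemma evB_disconnected (A : pred 'I_n) (t : btree n) :
  (forall a b, a \in leaves t -> b \in leaves t -> A a -> ~~ A b -> qtriv q a b) ->
  has A (leaves t) -> has (predC A) (leaves t) -> zeroB q (evB q t).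
Proof.
elim: t => [a|t IHt t' IHt'] cut /=; first by case: (A a).
have {}IHt : has A (leaves t) -> has (predC A) (leaves t) -> zeroB q (evB q t).
  by apply: IHt => a b at_ bt; apply: cut; rewrite mem_cat ?at_ ?bt.
have {}IHt' : has A (leaves t') -> has (predC A) (leaves t') -> zeroB q (evB q t').
  by apply: IHt' => a b at_ bt; apply: cut; rewrite mem_cat ?at_ ?bt orbT.
have [h1|n1] := boolP (has A (leaves t)); have [h2|n2] := boolP (has (predC A) (leaves t)).
- by move=> _ _; apply: zeroB_add; [apply: zeroB_mulTr|apply: zeroB_mulTl]; apply: IHt.
- rewrite !has_cat h1 (negPf n2) /= => _ h2'.
  have [h1'|n1'] := boolP (has A (leaves t')).
    by apply: zeroB_add; [apply: zeroB_mulTl|apply: zeroB_mulTr]; apply: IHt'.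
  apply: evB_node_zero; apply/allrelP => a b at_ bt; rewrite qtriv_sym; apply: cut.
  - by rewrite mem_cat bt.
  - by rewrite mem_cat at_ orbT.
  - by move: n2; rewrite has_predC negbK => /allP; apply.
  by move: n1'; rewrite -all_predC => /allP; apply.
- rewrite !has_cat h2 (negPf n1) /= => h1' _.
  have [h2'|n2'] := boolP (has (predC A) (leaves t')).
    by apply: zeroB_add; [apply: zeroB_mulTl|apply: zeroB_mulTr]; apply: IHt'.
  apply: evB_node_zero; apply/allrelP => a b at_ bt; apply: cut.
  - by rewrite mem_cat at_ orbT.
  - by rewrite mem_cat bt.
  - by move: n2'; rewrite has_predC negbK => /allP; apply.
  by move: n1; rewrite -all_predC => /allP; apply.
rewrite !has_cat (negPf n1) (negPf n2) /= => h1' h2'.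
by apply: zeroB_add; [apply: zeroB_mulTl|apply: zeroB_mulTr]; apply: IHt'.
Qed.

(** All trees of a homogeneous expansion have the letters of [w], hence meet both sides of the
    cut. *)
Lemma inL_disconnected w : L w -> ~~ connected_word q w -> zeroB q (mono w).
Proof.
move=> /inL_mono_homogeneous[l lw /eqBP El] /disconnected_wordP[A [hA hnA cut]] s.
rewrite El evalD_lincomb; transitivity (\sum_(p <- l) (0 : F)); last by rewrite big1.
apply: (eq_sum_all lw) => p pw; rewrite (@evB_disconnected A) ?mulr0 //.
- by move=> a b; rewrite !(perm_mem pw); apply: cut.
- by rewrite (perm_has _ pw).
by rewrite (perm_has _ pw).
Qed.

(** If [d] commuted with all the rest, connectedness would force a power of x_d with q_dd = -1,
    which vanishes. *)
Lemma good_nonzero_attached x d y : (0 < size (x ++ y))%N -> good_word q (x ++ d :: y) ->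
  ~ zeroB q (mono (x ++ d :: y)) -> ~~ all (qtriv q d) (x ++ y).
Proof.
move=> s0 [C nq] nz; apply/negP => td; set w := x ++ d :: y in C nq nz.
have dw : d \in w by rewrite mem_cat mem_head orbT.
have [wd|/(connected_neighbor C dw)[b bw /andP[bd]]] := boolP (all (pred1 d) w); last first.
  rewrite (allP td) //; move: bw.
  by rewrite /w !mem_cat inE (negPf bd).
have sw : (1 < size w)%N by rewrite size_cat addnS -size_cat.
case: nz => s; have qd := nq d sw wd; have tdd : qtriv q d d.
  apply: (allP td); have : all (pred1 d) (x ++ y) by move: wd; rewrite !all_cat /= => /and3P[-> _ ->].
  by case: (x ++ y) s0 => // e z _ /= /andP[/eqP-> _]; rewrite mem_head.
move: sw (all_pred1P _ _ wd); case: (w) => [|? [|? z]] // _ [-> -> _].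
exact: (@pairing_sq _ _ _ [::]).
Qed.

Lemma permw_exists h h' : perm_eq h' h -> exists tau : 'S_(size h), permw tau = h'.
Proof.
move=> /(@tuple_permP _ _ _ (in_tuple h))[tau ->]; exists tau.
by rewrite /permw -val_ord_tuple.
Qed.
End ConnectedMonomials.

Theorem theorem2p4 (F : closedFieldType) (HF : [pchar F] =i pred0)
  (n : nat) (q : 'I_n -> 'I_n -> F) (Hq : forall i j, q i j != 0)
  (h : seq 'I_n) (Hm : (2 <= size h)%N)
  (Hh1 : forall a, ohead h = Some a -> [set x in h] = [set a] -> q a a != 1) :
  (* (a) *)
  (( (inL q (mono (take (size h).-1 h)) /\
      diamond q (take (size h).-1 h) (drop (size h).-1 h))
   \/ (inL q (mono (behead h)) /\ diamond q (behead h) (take 1 h)))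
   -> inL q (mono h))
  /\
  (* (b) *)
  (~ zeroB q (mono h) -> inL q (mono h) ->
   exists tau : 'S_(size h),
     simB q (mono h) (mono (permw tau)) /\
     ( (~ zeroB q (mono (take (size h).-1 (permw tau))) /\
        inL q (mono (take (size h).-1 (permw tau))) /\
        diamond q (take (size h).-1 (permw tau)) (drop (size h).-1 (permw tau)))
     \/ (~ zeroB q (mono (behead (permw tau))) /\
         inL q (mono (behead (permw tau))) /\
         diamond q (behead (permw tau)) (take 1 (permw tau)))))
  /\
  (* (c) *)
  (connected_word q h -> inL q (mono h)).
Proof.
have h0 : h != [::] by case: (h) Hm.
have good_h : connected_word q h -> good_word q h.
  move=> C; split=> // a _ /all_pred1P ha; apply: Hh1; first by rewrite ha; case: (h) h0.
  by apply/setP => b; rewrite !inE ha mem_nseq lt0n size_eq0 h0.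
have partc : connected_word q h -> inL q (mono h) by move=> /good_h; apply: inL_good.
have diamond1 w a : diamond q w [:: a] = ~~ all (qtriv q a) w.
  by rewrite -has_predC; apply: eq_has => b; rewrite has_seq1 /= /qtriv mulrC.
have inL_step w x a : perm_eq h (a :: w) -> h = x ++ w \/ h = w ++ x ->
    inL q (mono w) -> ~~ all (qtriv q a) w -> inL q (mono h).
  (* If [w] is connected, so is [h], and (c) applies; otherwise [w] vanishes, and [h] with it. *)
  move=> ph Eh Lw naw; have [C|nC] := boolP (connected_word q w).
    by apply: partc; rewrite (eq_connected_word q (perm_mem ph)); apply: connected_attach.
  apply: inL_zero; have Zw := inL_disconnected Lw nC; case: Eh => ->.
    by have := zeroB_mono_ctx x [::] Zw; rewrite cats0.
  exact: (zeroB_mono_ctx [::] x Zw).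
split; last split=> //.
  case=> -[].
    case/lastP: h h0 inL_step {Hm Hh1 good_h partc} => // w a _ inL_step.
    rewrite -cats1 size_cat addn1 /= take_size_cat // drop_size_cat // diamond1 => Lw naw.
    rewrite -cats1 in inL_step; apply: (inL_step w [:: a] a) => //; last by right.
    by rewrite perm_catC.
  case: h h0 inL_step {Hm Hh1 good_h partc} => // a w _ inL_step /=.
  rewrite take0 diamond1 => Lw naw.
  by apply: (inL_step w [:: a] a) => //; left.
move=> nz Lh.
have C : connected_word q h by apply: contra_notT nz; apply: inL_disconnected.
have [x [d [y [Eh gxy comm]]]] := good_remove Hm (good_h C).
have sxy : size h = (size (x ++ y)).+1 by rewrite Eh size_cat addnS -size_cat.
have xy0 : (0 < size (x ++ y))%N by rewrite -ltnS -sxy.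
have nd : ~~ all (qtriv q d) (x ++ y).
  by rewrite Eh in nz good_h C; apply: good_nonzero_attached nz => //; apply: good_h.
have Lxy : inL q (mono (x ++ y)) by apply: inL_good => //; rewrite -size_eq0 -lt0n.
(* Moving [d] to an end changes [h] only by a scalar; the remaining factor is nonzero because [h]
   is. *)
case/orP: comm => td.
  have [tau Et] : exists tau : 'S_(size h), permw tau = d :: x ++ y.
    by apply: permw_exists; rewrite Eh; perm_count.
  have S : simB q (mono h) (mono (d :: x ++ y)).
    exists (chiw q x [:: d]); split; first exact: chiw_neq0.
    apply/eqBP => s; rewrite evalD_scale Eh; exact: (pairing_move [::] y s td).
  exists tau; rewrite Et; split=> //; right; rewrite /= take0 diamond1; split=> // Z.
  case: nz => s; have [c [_ /eqBP->]] := S; rewrite evalD_scale.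
  by have := zeroB_mono_ctx [:: d] [::] Z; rewrite cats0 => ->; rewrite mulr0.
have [tau Et] : exists tau : 'S_(size h), permw tau = (x ++ y) ++ [:: d].
  by apply: permw_exists; rewrite Eh; perm_count.
have S : simB q (mono h) (mono ((x ++ y) ++ [:: d])).
  have k0 := chiw_neq0 Hq y [:: d].
  (* Inverse, since [pairing_move] carries [d] leftwards, from the end back to its place in [h]. *)
  exists (chiw q y [:: d])^-1; split; first by rewrite invr_eq0.
  apply/eqBP => s; rewrite evalD_scale Eh -catA -!/(pairing _ _ _).
  by rewrite (pairing_move x [::] s td) cats0 mulKf.
exists tau; rewrite Et; split=> //; left.
rewrite sxy take_size_cat // drop_size_cat // diamond1; split=> // Z.
case: nz => s; have [c [_ /eqBP->]] := S; rewrite evalD_scale.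
by have := zeroB_mono_ctx [::] [:: d] Z => /= ->; rewrite mulr0.
Qed.
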